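(* Let $d\in\{2,3\}$, $S>0$, $t>0$ and $0<\overline{\eta}<S$. Then $$P\{\mathcal{E}_d(t)>\overline{\eta}\}=P\{\eta_d(t)>\overline{\eta}\}-P\{\eta_d(t)>S^2/\overline{\eta}\}.$$
   Context: $\eta_d(t)$ is the hyperbolic distance at time $t$ from the origin $(0,\dots,0,1)$ of hyperbolic Brownian motion on the Poincaré half-space $\mathbb{H}_d=\{(x_1,\dots,x_d): x_d>0\}$ (metric $ds^2=x_d^{-2}\sum_{i=1}^d dx_i^2$), started at that origin; it satisfies $d\eta_d(t)=\frac{d-1}{2\tanh\eta_d(t)}dt+dW(t)$, $\eta_d(0)=0$, with $W$ a standard Wiener process, and for $t>0$ it has a probability density on $(0,\infty)$. The reflecting hyperbolic Bessel process in the hyperbolic ball of radius $S$ centred at the origin is $\mathcal{E}_d(t)=\eta_d(t)$ if $\eta_d(t)\in(0,S)$ and $\mathcal{E}_d(t)=S^2/\eta_d(t)$ if $\eta_d(t)\in[S,\infty)$. *)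

(* Defs.v *)
From HB Require Import structures.
From mathcomp Require Import all_boot all_order all_algebra.
From mathcomp Require Import all_classical all_reals all_analysis.

Set Implicit Arguments.
Unset Strict Implicit.
Unset Printing Implicit Defensive.

Import Order.TTheory GRing.Theory Num.Theory.
Import numFieldNormedType.Exports.

Local Open Scope classical_set_scope.
Local Open Scope ring_scope.

(* Points of R^d as row vectors.  The length is written d.-1.+1, which is d
   for every d >= 1, so that the last coordinate x_d is the index ord_max. *)
Notation point R d := ('rV[R]_d.-1.+1) (only parsing).

Section HalfSpace.
Context {R : realType} (d : nat).
Implicit Types (x y : point R d) (f : point R d -> R).

Definition height x : R := x 0 ord_max.

Definition half_space : set (point R d) := [set x | 0 < height x].

(* The point (0, ..., 0, 1). *)
Definition origin : point R d := delta_mx 0 ord_max.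

(* The norm of the library on row vectors is the sup norm, whereas the metric
   of the half-space is conformal to the Euclidean one. *)
Definition euclidean_norm x : R := Num.sqrt (\sum_i x 0 i ^+ 2).

(* C^1 curves in the half-space from x to y, parametrised by [0, 1].  Asking
   for differentiability on the whole line costs nothing, since a C^1 curve on
   [0, 1] extends to R; only the part over [0, 1] must stay in the half-space. *)
Definition C1_curve x y (c : R -> point R d) : Prop :=
  [/\ forall s, derivable c s 1,
      continuous (derive1 c),
      forall s, 0 <= s <= 1 -> half_space (c s),
      c 0 = x & c 1 = y].

(* Length for ds^2 = x_d^-2 * (dx_1^2 + ... + dx_d^2). *)
Definition hyperbolic_length (c : R -> point R d) : R :=
  \int[lebesgue_measure]_(s in `[0, 1])
     (euclidean_norm (derive1 c s) / height (c s)).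

Definition hyperbolic_distance x y : R :=
  inf [set l | exists2 c, C1_curve x y c & l = hyperbolic_length c].

Definition partial (i : 'I_d.-1.+1) f x : R := 'D_(delta_mx 0 i) f x.

(* Twice continuously differentiable functions with compact support contained
   in the half-space. *)
Definition test_function f : Prop :=
  [/\ forall i x, derivable f x (delta_mx 0 i),
      forall i, continuous (partial i f),
      forall i j x, derivable (partial i f) x (delta_mx 0 j),
      forall i j, continuous (partial j (partial i f)) &
      exists K, [/\ compact K, K `<=` half_space &
                    forall x, ~ K x -> f x = 0]].

(* Laplace-Beltrami operator of the metric x_d^-2 * (dx_1^2 + ... + dx_d^2). *)
Definition hyperbolic_laplacian f x : R :=
  height x ^+ 2 * (\sum_i partial i (partial i f) x)
  - (d%:R - 2) * height x * partial ord_max f x.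

End HalfSpace.

Section Processes.
Context {R : realType} {dT : measure_display} {T : measurableType dT}
        (P : probability T R).

(* The sigma-algebra generated by the real random variables Y u i with
   0 <= u <= s. *)
Definition past (I : Type) (Y : R -> I -> T -> R) (s : R) : set (set T) :=
  <<s [set A | exists u i B, [/\ 0 <= u <= s, measurable B &
                                 A = Y u i @^-1` B]] >>.

(* normal_prob m s is the Gaussian law of mean m and standard deviation s. *)
Definition wiener_process (W : R -> {RV P >-> R}) : Prop :=
  [/\ forall w, W 0 w = 0,
      forall w, {within `[0, +oo[, continuous (fun t => W t w)},
      forall (s t : R) (B : set R), 0 <= s -> s < t -> measurable B ->
        P [set w | B (W t w - W s w)]
        = normal_prob 0 (Num.sqrt (t - s)) B &
      forall (s t : R) (A : set T) (B : set R), 0 <= s -> s < t ->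
        past (fun u (_ : unit) => W u) s A -> measurable B ->
        P (A `&` [set w | B (W t w - W s w)])
        = (P A * P [set w | B (W t w - W s w)%R])%E].

(* Hyperbolic Brownian motion started at the origin: the continuous process on
   the half-space solving the martingale problem for half the Laplace-Beltrami
   operator.  The last clause says that
     f (X t) - \int_0^t (1/2) (Laplacian f) (X u) du
   is a martingale for the natural filtration of X. *)
Definition hyperbolic_brownian_motion (d : nat) (X : R -> T -> point R d)
    : Prop :=
  [/\ forall t i, 0 <= t -> measurable_fun setT (fun w => X t w 0 i),
      forall t w, 0 <= t -> half_space (X t w),
      forall w, X 0 w = origin d,
      forall w, {within `[0, +oo[, continuous (fun t => X t w)} &
      forall f (s t : R) (A : set T), test_function f -> 0 <= s -> s <= t ->
        past (fun u i w => X u w 0 i) s A ->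
        \int[P]_(w in A)
          (f (X t w) - f (X s w)
           - \int[lebesgue_measure]_(u in `[s, t])
               (2^-1 * hyperbolic_laplacian f (X u w))) = 0].

Definition tanh (x : R) : R := (expR x - expR (- x)) / (expR x + expR (- x)).

(* d eta = (d - 1) / (2 tanh eta) dt + dW with eta(0) = 0.  The noise is
   additive, so the integrated equation is understood path by path. *)
Definition hyperbolic_bessel_sde (d : nat) (W eta : R -> {RV P >-> R}) : Prop :=
  {ae P, forall w, forall t, 0 <= t ->
    lebesgue_measure.-integrable `[0, t]
      (fun s => ((d%:R - 1) / (2 * tanh (eta s w)))%:E) /\
    eta t w = \int[lebesgue_measure]_(s in `[0, t])
                ((d%:R - 1) / (2 * tanh (eta s w))) + W t w}.

(* Y has a probability density, carried by (0, +oo). *)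
Definition has_density_on_pos (Y : {RV P >-> R}) : Prop :=
  exists p : R -> R,
    [/\ measurable_fun setT p, forall x, 0 <= p x &
        forall B : set R, measurable B ->
          P (Y @^-1` B)
          = (\int[lebesgue_measure]_(x in B `&` `]0%R, +oo[) (p x)%:E)%E].

(* The value at eta t w = 0, an event of probability zero for t > 0, is 0. *)
Definition reflecting_process (S : R) (eta : R -> {RV P >-> R}) (t : R) (w : T)
    : R :=
  if eta t w < S then eta t w else S ^+ 2 / eta t w.

End Processes.

(* Main.v *)
Require Import Defs.
From HB Require Import structures.
From mathcomp Require Import all_boot all_order all_algebra.
From mathcomp Require Import all_classical all_reals all_analysis.
From mathcomp Require Import measurable_realfun.

Set Implicit Arguments.
Unset Strict Implicit.
Unset Printing Implicit Defensive.

Import Order.TTheory GRing.Theory Num.Theory.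
Import numFieldNormedType.Exports.

Local Open Scope classical_set_scope.
Local Open Scope ring_scope.

(** The reflection $x\mapsto S^2/x$ is decreasing on $(0,\infty)$ and fixes $S$, so for $0<a<S$ the
    process exceeds $a$ exactly when $a<\eta<S^2/a$ ([lt_reflecting_process], a pointwise fact).
    This event is $\{\eta>a\}$ minus its subset $\{\eta\ge S^2/a\}$, so its probability is a
    difference. Since $\eta_d(t)$ has a density, there is no atom at $S^2/a$, and $\ge$ may be
    replaced by $>$ ([has_density_on_pos_ge_gt]). *)

Section DensityOnPos.
Context {R : realType} {dT : measure_display} {T : measurableType dT}.
Variable P : probability T R.

(** A law with a density has no atoms. As $0<c$, both half-lines lie in $(0,\infty)$, so restricting
    to the carrier changes nothing, and the two integrals differ only at the null point $c$. *)
Lemma has_density_on_pos_ge_gt (Y : {RV P >-> R}) (c : R) :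
  has_density_on_pos Y -> 0 < c ->
  P [set w | (c <= Y w)%R] = P [set w | (c < Y w)%R].
Proof.
move=> [p [mp _ PYE]] c0.
have in_pos (A : set R) : A `<=` `[c, +oo[ -> A `&` `]0, +oo[ = A.
  move=> Ac; apply/setIidl => x /Ac /=.
  by rewrite !in_itv /= !andbT; exact: lt_le_trans.
rewrite -preimage_itvcy -preimage_itvoy !PYE// !in_pos//; last first.
  by move=> x /=; rewrite !in_itv /= !andbT; exact: ltW.
rewrite integral_itv_obnd_cbnd//.
by apply/measurable_EFinP; exact: measurable_funTS.
Qed.

End DensityOnPos.

Section ReflectingProcess.
Context {R : realType} {dT : measure_display} {T : measurableType dT}.
Context {P : probability T R}.

(** Below $S$ the upper bound is automatic, because $a<S$ gives $S<S^2/a$; from $S$ on, the lower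
    bound is automatic. *)
Lemma lt_reflecting_process (S a : R) (eta : R -> {RV P >-> R}) (t : R) (w : T) :
  0 < a < S ->
  (a < reflecting_process S eta t w) = (a < eta t w < S ^+ 2 / a).
Proof.
move=> /andP[a0 aS]; have S0 : 0 < S := lt_trans a0 aS.
have SS2a : S < S ^+ 2 / a by rewrite ltr_pdivlMr// expr2 ltr_pM2l.
rewrite /reflecting_process; case: (ltP (eta t w) S) => [etaS|Seta].
  by rewrite (lt_trans etaS SS2a) andbT.
rewrite (lt_le_trans aS Seta) /=.
(* Both sides clear denominators to $a\,\eta<S^2$; here $\eta\ge S>0$. *)
by rewrite !ltr_pdivlMr ?(lt_le_trans S0 Seta)// mulrC.
Qed.

End ReflectingProcess.

Theorem mainTheorem9 (R : realType) (dT : measure_display)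
  (T : measurableType dT) (P : probability T R)
  (d : nat) (hd : d = 2%N \/ d = 3%N)
  (X : R -> T -> 'rV[R]_d.-1.+1) (hX : hyperbolic_brownian_motion P X)
  (eta : R -> {RV P >-> R})
  (eta_distance : forall t w, 0 <= t ->
     eta t w = hyperbolic_distance (origin d) (X t w))
  (W : R -> {RV P >-> R}) (hW : wiener_process W)
  (eta_sde : hyperbolic_bessel_sde d W eta)
  (eta_density : forall t, 0 < t -> has_density_on_pos (eta t))
  (S t etabar : R) (hS : 0 < S) (ht : 0 < t) (hetabar : 0 < etabar < S) :
  (P [set w | (etabar < reflecting_process S eta t w)%R]
   = P [set w | (etabar < eta t w)%R]
     - P [set w | (S ^+ 2 / etabar < eta t w)%R])%E.
Proof.
have [a0 aS] := andP hetabar.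
set c := S ^+ 2 / etabar.
have ac : etabar < c.
  by rewrite (lt_trans aS)// ltr_pdivlMr// expr2 ltr_pM2l.
have mgt : measurable [set w | etabar < eta t w].
  by rewrite -preimage_itvoy; exact: measurable_funPTI.
have mge : measurable [set w | c <= eta t w].
  by rewrite -preimage_itvcy; exact: measurable_funPTI.
(* Passing to the weak inequality makes the event below an exact set difference, with no boundary
   case at [c]. *)
rewrite -(has_density_on_pos_ge_gt (eta_density _ ht) (lt_trans a0 ac)).
have -> : [set w | etabar < reflecting_process S eta t w] =
    [set w | etabar < eta t w] `\` [set w | c <= eta t w].
  apply/seteqP; split=> w /=; rewrite lt_reflecting_process//.
    by move=> /andP[-> ]; rewrite ltNge => /negP.
  by move=> [-> /negP]; rewrite -ltNge.
rewrite measureD//; last by rewrite ltey_eq fin_num_measure.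
(* [measureD] subtracts the measure of the intersection, which is the smaller event since
   [etabar < c]. *)
congr (_ - P _)%E; apply/setIidr => w /=; exact: lt_le_trans.
Qed.
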